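(* For any monoid $M$, the set $\mathscr L^+(M)=\{\mathbb X(M):\mathbb X\in\mathscr F^+\}$ is a finite $\vee$-subsemilattice of $\operatorname{Sub}(M)$, with top element $\mathbb I(M)=M$ and bottom element $\mathbb O(M)=\{1\}$. Consequently, $\mathscr L^+(M)$ (ordered by inclusion) is a lattice.
   Context: Submonoids of a monoid $M$ contain its identity $1$. $\operatorname{Sub}(M)$ is the lattice of all submonoids of $M$, with meet $S\wedge T=S\cap T$ and join $S\vee T=\langle S\cup T\rangle$, where $\langle A\rangle$ denotes the submonoid generated by $A$. An element $x\in M$ is a left unit if $ax=1$ for some $a\in M$, a right unit if $xa=1$ for some $a\in M$. Define, for every monoid $M$: $\mathbb O(M)=\{1\}$; $\mathbb I(M)=M$; $\mathbb E(M)$ is generated by all idempotents of $M$; $\mathbb G_L(M)$ is the set of left units; $\mathbb G_R(M)$ the set of right units; $\mathbb G(M)=\mathbb G_L(M)\cap\mathbb G_R(M)$; $\mathbb G_{LR}(M)=\langle\mathbb G_L(M)\cup\mathbb G_R(M)\rangle$; $\mathbb F(M)=\langle\mathbb E(M)\cup\mathbb G(M)\rangle$; $\mathbb F_L(M)=\langle\mathbb E(M)\cup\mathbb G_L(M)\rangle$; $\mathbb F_R(M)=\langle\mathbb E(M)\cup\mathbb G_R(M)\rangle$; $\mathbb F_{LR}(M)=\langle\mathbb E(M)\cup\mathbb G_L(M)\cup\mathbb G_R(M)\rangle$. Further define $\mathbb Q(M)=\mathbb E(\mathbb G_{LR}(M))$, $\mathbb P(M)=\mathbb F(\mathbb G_{LR}(M))$,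 $\mathbb P_L(M)=\mathbb F_L(\mathbb G_{LR}(M))$, $\mathbb P_R(M)=\mathbb F_R(\mathbb G_{LR}(M))$ (each operator applied to the monoid $\mathbb G_{LR}(M)$). Finally $\mathscr F^+=\{\mathbb O,\mathbb E,\mathbb G,\mathbb G_L,\mathbb G_R,\mathbb G_{LR},\mathbb F,\mathbb F_L,\mathbb F_R,\mathbb F_{LR},\mathbb Q,\mathbb P,\mathbb P_L,\mathbb P_R,\mathbb I\}$. *)

(* Defs.v *)
From HB Require Import structures.
From Stdlib Require List.
From mathcomp Require Import all_boot all_order.
From mathcomp Require Import boolp classical_sets cardinality.

Set Implicit Arguments.
Unset Strict Implicit.
Unset Printing Implicit Defensive.

Import Order.TTheory.

Local Open Scope classical_set_scope.
Local Open Scope group_scope.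

Definition submonoid_closed (M : monoidType) (A : set M) : Prop :=
  monoid_closed (mem A).

(* The closure condition is boolean so that [submonoid M] is a subType of
   [set M] and inherits inclusion as its order. *)
Record submonoid (M : monoidType) := Submonoid {
  submonoid_set :> set M;
  _ : `[< submonoid_closed submonoid_set >] }.

HB.instance Definition _ (M : monoidType) :=
  [isSub for @submonoid_set M].
HB.instance Definition _ (M : monoidType) :=
  [Choice of submonoid M by <:].

Lemma submonoid_closedP (M : monoidType) (A : set M) :
  submonoid_closed A <-> A 1 /\ (forall x y, A x -> A y -> A (x * y)).
Proof.
split=> -[A1 AM]; split; first exact/set_mem.
- by move=> x y Ax Ay; apply/set_mem/AM; apply/mem_set.
- exact/mem_set.
- by move=> x y /set_mem Ax /set_mem Ay; apply/mem_set/AM.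
Qed.

Definition mk_submonoid (M : monoidType) (A : set M)
    (A1 : A 1) (AM : forall x y, A x -> A y -> A (x * y)) : submonoid M :=
  Submonoid (asboolT (proj2 (submonoid_closedP A) (conj A1 AM))).

Lemma submonoid1 (M : monoidType) (S : submonoid M) : submonoid_set S 1.
Proof. by case: S => A /= /asboolP/submonoid_closedP[]. Qed.

Lemma submonoidM (M : monoidType) (S : submonoid M) x y :
  submonoid_set S x -> submonoid_set S y -> submonoid_set S (x * y).
Proof. by case: S => A /= /asboolP/submonoid_closedP[_]; apply. Qed.

Lemma smallest_submonoid1 (M : monoidType) (A : set M) :
  smallest (@submonoid_closed M) A 1.
Proof. by move=> B [/submonoid_closedP[]]. Qed.

Lemma smallest_submonoidM (M : monoidType) (A : set M) x y :
  smallest (@submonoid_closed M) A x -> smallest (@submonoid_closed M) A y ->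
  smallest (@submonoid_closed M) A (x * y).
Proof.
move=> Ax Ay B AB; case/submonoid_closedP: (AB.1) => _; apply.
  exact: Ax.
exact: Ay.
Qed.

Definition gen (M : monoidType) (A : set M) : submonoid M :=
  mk_submonoid (smallest_submonoid1 (A := A)) (@smallest_submonoidM M A).

Lemma gen_sub (M : monoidType) (A : set M) : A `<=` gen A.
Proof. exact: sub_gen_smallest. Qed.

Lemma gen_min (M : monoidType) (A : set M) (S : submonoid M) :
  A `<=` S -> gen A `<=` S.
Proof.
by apply: smallest_sub; case: S => B /= /asboolP.
Qed.

Definition submonoid_meet (M : monoidType) (S T : submonoid M) : submonoid M :=
  mk_submonoid (A := S `&` T)
    (conj (submonoid1 S) (submonoid1 T))
    (fun x y Ax Ay => conj (submonoidM Ax.1 Ay.1) (submonoidM Ax.2 Ay.2)).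

Definition submonoid_join (M : monoidType) (S T : submonoid M) : submonoid M :=
  gen (S `|` T).

Fact submonoid_display : Order.disp_t. Proof. exact: Order.Disp tt tt. Qed.

HB.instance Definition _ (M : monoidType) :=
  [SubChoice_isSubPOrder of submonoid M by <: with submonoid_display].

Lemma leSubE (M : monoidType) (S T : submonoid M) :
  (S <= T)%O = (S `<=` T) :> Prop.
Proof. by rewrite -subsetEset. Qed.

Lemma submonoid_meetP (M : monoidType) (S T U : submonoid M) :
  (S <= submonoid_meet T U)%O = (S <= T)%O && (S <= U)%O.
Proof.
apply/idP/andP => [|[]]; rewrite !leSubE; last by move=> ST SU; rewrite subsetI.
by rewrite subsetI.
Qed.

Lemma submonoid_joinP (M : monoidType) (S T U : submonoid M) :
  (submonoid_join S T <= U)%O = (S <= U)%O && (T <= U)%O.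
Proof.
apply/idP/andP => [|[]]; rewrite !leSubE.
  by move=> STU; split; apply: subset_trans STU => x Sx; apply: gen_sub;
     [left|right].
by move=> SU TU; apply: gen_min; rewrite subUset.
Qed.

HB.instance Definition _ (M : monoidType) :=
  Order.POrder_MeetJoin_isLattice.Build submonoid_display (submonoid M)
    (@submonoid_meetP M) (@submonoid_joinP M).

(* A definition rather than a plain sig, so that the monoid structure below
   has its own key. *)
Definition submonoid_type (M : monoidType) (S : submonoid M) : Type :=
  {x : M | x \in (S : set M)}.

HB.instance Definition _ (M : monoidType) (S : submonoid M) :=
  SubChoice.on (submonoid_type S).

Lemma submonoid_mem_closed (M : monoidType) (S : submonoid M) :
  monoid_closed (fun x => x \in (S : set M)).
Proof. by case: S => A /= /asboolP. Qed.

HB.instance Definition _ (M : monoidType) (S : submonoid M) :=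
  SubChoice_isSubMonoid.Build M _ (submonoid_type S) (submonoid_mem_closed S).

Section Operators.
Variable M : monoidType.

Section Embed.
Variables (S : submonoid M) (T : submonoid (submonoid_type S)).

Definition embed_set : set M :=
  [set val x | x in (T : set (submonoid_type S))].

Lemma embed_set1 : embed_set 1.
Proof. by exists 1; [exact: submonoid1|exact: val1]. Qed.

Lemma embed_setM x y : embed_set x -> embed_set y -> embed_set (x * y).
Proof.
move=> [u Tu <-] [v Tv <-]; exists (u * v); first exact: submonoidM.
exact: valM.
Qed.

Definition embed : submonoid M := mk_submonoid embed_set1 embed_setM.
End Embed.

Definition idempotents : set M := [set x | x * x = x].
Definition left_units : set M := [set x | exists a, a * x = 1].
Definition right_units : set M := [set x | exists a, x * a = 1].

Lemma left_units1 : left_units 1. Proof. by exists 1; rewrite mulg1. Qed.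
Lemma left_unitsM x y : left_units x -> left_units y -> left_units (x * y).
Proof.
by move=> [a ax] [b b_y]; exists (b * a); rewrite -mulgA (mulgA a) ax mul1g.
Qed.
Lemma right_units1 : right_units 1. Proof. by exists 1; rewrite mulg1. Qed.
Lemma right_unitsM x y : right_units x -> right_units y -> right_units (x * y).
Proof.
by move=> [a xa] [b yb]; exists (b * a); rewrite -mulgA (mulgA y) yb mul1g.
Qed.

Lemma one_set1 : [set 1 : M] 1. Proof. by []. Qed.
Lemma one_setM (x y : M) : [set 1] x -> [set 1] y -> [set 1] (x * y).
Proof. by move=> /= -> ->; rewrite mulg1. Qed.

Definition opO : submonoid M := mk_submonoid one_set1 one_setM.
Definition opI : submonoid M :=
  mk_submonoid (A := [set: M]) Logic.I (fun _ _ _ _ => Logic.I).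
Definition opE : submonoid M := gen idempotents.
Definition opGL : submonoid M := mk_submonoid left_units1 left_unitsM.
Definition opGR : submonoid M := mk_submonoid right_units1 right_unitsM.
Definition opG : submonoid M := (opGL `&` opGR)%O.
Definition opGLR : submonoid M := gen (opGL `|` opGR).
Definition opF : submonoid M := gen (opE `|` opG).
Definition opFL : submonoid M := gen (opE `|` opGL).
Definition opFR : submonoid M := gen (opE `|` opGR).
Definition opFLR : submonoid M := gen (opE `|` opGL `|` opGR).
End Operators.

(* The operators of the monoid opGLR M yield submonoids of that monoid; embed
   sends them to submonoids of M. *)
Definition opQ (M : monoidType) : submonoid M :=
  embed (opE (submonoid_type (opGLR M))).
Definition opP (M : monoidType) : submonoid M :=
  embed (opF (submonoid_type (opGLR M))).
Definition opPL (M : monoidType) : submonoid M :=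
  embed (opFL (submonoid_type (opGLR M))).
Definition opPR (M : monoidType) : submonoid M :=
  embed (opFR (submonoid_type (opGLR M))).

(* A list rather than a [set]: the type of operators quantifies over all
   monoids, and is too large for the universe of [set]. *)
Definition Fplus : seq (forall M : monoidType, submonoid M) :=
  [:: opO; opE; opG; opGL; opGR; opGLR; opF; opFL; opFR; opFLR;
      opQ; opP; opPL; opPR; opI].

Definition Lplus (M : monoidType) : set (submonoid M) :=
  [set S | exists2 X, List.In X Fplus & S = X M].
Arguments Lplus M : clear implicits.

HB.instance Definition _ d (T : porderType d) (A : set T) :=
  SubChoice.on (set_type A).
HB.instance Definition _ d (T : porderType d) (A : set T) :=
  [SubChoice_isSubPOrder of set_type A by <: with d].

Definition is_lattice d (T : porderType d) : Prop :=
  forall x y : T, supremums [set x; y] !=set0 /\ infimums [set x; y] !=set0.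

(* Main.v *)
Require Import Defs.
From HB Require Import structures.
From mathcomp Require Import all_boot all_order.
From mathcomp Require Import boolp classical_sets cardinality.

(** The fifteen submonoids form, apart from the top [opI M], a grid.  One
    direction of the grid is the chain [opO <= opQ <= opE] of idempotent-generated
    submonoids, the other is the five-element family [opO], [opG], [opGL],
    [opGR], [opGLR] generated by one-sided units.  Both families are closed under
    joins, and every other member of the list is the join of an element of the
    first with an element of the second ([LplusP]); conversely all fifteen such
    joins are listed: one of them is [opQ `|` opGLR], which is [opGLR] again, as
    [opQ] is computed inside [opGLR].  Since joins may be regrouped, the joins of
    one element of each family are themselves closed under joins.

    The work lies in placing the last four operators in the grid, as they are
    computed inside the monoid [opGLR M].  The embedding of the submonoids of [S]
    into those of [M] has an upper adjoint ([le_embed]), so it preserves joins.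
    Moreover a one-sided inverse of a one-sided unit is a one-sided unit of the
    other kind, so [opGLR M] has the same one-sided units as [M].

    Finally a finite join-closed set with a least element has infima: the
    infimum of two elements is the join of their finitely many common lower
    bounds ([finite_join_closed_is_lattice]). *)

Set Implicit Arguments.
Unset Strict Implicit.
Unset Printing Implicit Defensive.

Import Order.TTheory.

Local Open Scope classical_set_scope.
Local Open Scope group_scope.

(** * Finite join-closed sets *)

Section FiniteJoinSemilattice.
Context {d : Order.disp_t} {T : latticeType d}.
Implicit Types (A : set T) (s : seq T).

Lemma foldr_join_closed A s m :
    (forall x y, A x -> A y -> A (x `|` y)%O) -> A m ->
  {in s, forall z, A z} -> A (foldr Order.join m s).
Proof.
move=> AU Am; elim: s => //= z s IHs As; apply: AU.
  by apply: As; rewrite mem_head.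
by apply: IHs => t ts; apply: As; rewrite inE ts orbT.
Qed.

Lemma foldr_join_ub s m z : z \in s -> (z <= foldr Order.join m s)%O.
Proof.
elim: s => //= t s IHs; rewrite inE => /orP[/eqP ->|/IHs zs].
  exact: leUl.
exact: le_trans zs (leUr _ _).
Qed.

Lemma foldr_join_le s m x :
  (m <= x)%O -> {in s, forall z, (z <= x)%O} -> (foldr Order.join m s <= x)%O.
Proof.
move=> mx; elim: s => //= t s IHs sx; rewrite leUx sx ?mem_head //=.
by apply: IHs => z zs; apply: sx; rewrite inE zs orbT.
Qed.

(** The least element [m] serves as the join of the empty family, which makes
    the join of the common lower bounds stay in [A]. *)
Lemma finite_join_closed_is_lattice A m :
    finite_set A -> (forall x y, A x -> A y -> A (x `|` y)%O) ->
  A m -> lbound A m -> is_lattice (set_type A).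
Proof.
move=> /finite_seqP[s As] AU Am mA x y.
have sA t : A t -> t \in s by rewrite As.
have Ax : A (val x) by apply: set_mem; exact: valP.
have Ay : A (val y) by apply: set_mem; exact: valP.
split.
  exists (SigSub (mem_set (AU _ _ Ax Ay))); split.
    by move=> _ [->|->]; rewrite -Order.le_val /=; [exact: leUl|exact: leUr].
  move=> z zub.
  have [xz yz] : (x <= z)%O /\ (y <= z)%O by split; apply: zub; [left|right].
  by move: xz yz; rewrite -!Order.le_val /= leUx => -> ->.
pose l := [seq z <- s | (z <= val x)%O && (z <= val y)%O].
have Al : A (foldr Order.join m l).
  apply: foldr_join_closed => // z; rewrite mem_filter => /andP[_ zs].
  by rewrite As.
exists (SigSub (mem_set Al)); split.
  move=> _ [->|->]; rewrite -Order.le_val /=; apply: foldr_join_le; try exact: mA;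
    by move=> z; rewrite mem_filter => /andP[/andP[]].
move=> z zlb; rewrite -Order.le_val /=; apply: foldr_join_ub.
have [zx zy] : (z <= x)%O /\ (z <= y)%O by split; apply: zlb; [left|right].
have zs : val z \in s by apply: sA; apply: set_mem; exact: valP.
by move: zx zy zs; rewrite -!Order.le_val mem_filter /= => -> ->.
Qed.

End FiniteJoinSemilattice.

(** * Embedding the submonoids of a submonoid *)

Section EmbedAdjunction.
Context {M : monoidType} {S : submonoid M}.
Implicit Types (T U : submonoid (submonoid_type S)) (V : submonoid M).

Definition trace V : submonoid (submonoid_type S) :=
  mk_submonoid (A := [set x : submonoid_type S | (V : set M) (val x)])
    (submonoid1 V) (fun x y Vx Vy => submonoidM (S := V) Vx Vy).

Lemma le_embed T V : (embed T <= V)%O = (T <= trace V)%O.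
Proof.
apply/idP/idP; rewrite !leSubE => TV.
  by move=> x Tx; apply: TV; exists x.
by move=> _ [x Tx <-]; exact: TV.
Qed.

(** Lower adjoints preserve joins. *)
Lemma embedU T U : embed (T `|` U)%O = (embed T `|` embed U)%O.
Proof.
apply/le_anti/andP; split.
  by rewrite le_embed leUx -!le_embed leUl leUr.
have : (T `|` U <= trace (embed (T `|` U)%O))%O by rewrite -le_embed.
by rewrite leUx => /andP[TTU UTU]; rewrite leUx !le_embed TTU.
Qed.

End EmbedAdjunction.

(** * One-sided units of the monoid they generate *)

Section OneSidedUnits.
Variable M : monoidType.

Lemma opGL_le : (opGL M <= opGLR M)%O. Proof. exact: leUl. Qed.
Lemma opGR_le : (opGR M <= opGLR M)%O. Proof. exact: leUr. Qed.

Lemma mem_opGLR (x : M) : left_units x \/ right_units x -> x \in (opGLR M : set M).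
Proof. by move=> xLR; apply/mem_set; exact: gen_sub xLR. Qed.

(** If [a * x = 1] then [a] is a right unit, so that the inverse witnessing
    that [x] is a left unit is found in [opGLR M] already. *)
Lemma embed_opGL : embed (opGL (submonoid_type (opGLR M))) = opGL M.
Proof.
apply/le_anti/andP; split; rewrite leSubE.
  by move=> _ [x [a ax1] <-]; exists (val a); rewrite -valM ax1.
move=> x [a ax1].
have Hx : x \in (opGLR M : set M) by apply: mem_opGLR; left; exists a.
have Ha : a \in (opGLR M : set M) by apply: mem_opGLR; right; exists x.
by exists (Sub x Hx : submonoid_type _) => //; exists (Sub a Ha); exact: val_inj.
Qed.

Lemma embed_opGR : embed (opGR (submonoid_type (opGLR M))) = opGR M.
Proof.
apply/le_anti/andP; split; rewrite leSubE.
  by move=> _ [x [a xa1] <-]; exists (val a); rewrite -valM xa1.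
move=> x [a xa1].
have Hx : x \in (opGLR M : set M) by apply: mem_opGLR; right; exists a.
have Ha : a \in (opGLR M : set M) by apply: mem_opGLR; left; exists x.
by exists (Sub x Hx : submonoid_type _) => //; exists (Sub a Ha); exact: val_inj.
Qed.

(** An embedding is injective, so it preserves the intersection of the two
    kinds of one-sided units. *)
Lemma embed_opG : embed (opG (submonoid_type (opGLR M))) = opG M.
Proof.
apply/le_anti/andP; split.
  rewrite lexI -{1}embed_opGL -embed_opGR; apply/andP.
  by split; rewrite leSubE => _ [x [xL xR] <-]; exists x.
rewrite leSubE => x [xL xR].
have [u uL ux] : submonoid_set (embed (opGL (submonoid_type (opGLR M)))) x.
  by rewrite embed_opGL.
have [v vR vx] : submonoid_set (embed (opGR (submonoid_type (opGLR M)))) x.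
  by rewrite embed_opGR.
have uv : u = v by apply: val_inj; rewrite ux vx.
by exists u => //; split=> //; rewrite uv.
Qed.

End OneSidedUnits.

(** * The grid of operators *)

Lemma opO_le (M : monoidType) (S : submonoid M) : (opO M <= S)%O.
Proof. by rewrite leSubE => _ ->; exact: submonoid1. Qed.

Lemma le_opI (M : monoidType) (S : submonoid M) : (S <= opI M)%O.
Proof. by rewrite leSubE. Qed.

Section Grid.
Variable M : monoidType.
Implicit Types a b S T : submonoid M.

(** Idempotents of a submonoid are idempotents of the whole monoid. *)
Lemma opQ_le_opE : (opQ M <= opE M)%O.
Proof.
rewrite le_embed leSubE; apply: gen_min => x xx.
by apply: (@gen_sub M (@idempotents M)); exact: (congr1 val (xx : x * x = x)).
Qed.

Lemma opQ_le_opGLR : (opQ M <= opGLR M)%O.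
Proof. by rewrite leSubE => _ [x _ <-]; apply: set_mem; exact: valP. Qed.

(** For any monoid [opF], [opFL] and [opFR] unfold to joins with [opE]; taken
    in [opGLR M], these joins survive the embedding. *)
Lemma opPE : opP M = (opQ M `|` opG M)%O.
Proof. by rewrite -embed_opG -embedU. Qed.

Lemma opPLE : opPL M = (opQ M `|` opGL M)%O.
Proof. by rewrite -embed_opGL -embedU. Qed.

Lemma opPRE : opPR M = (opQ M `|` opGR M)%O.
Proof. by rewrite -embed_opGR -embedU. Qed.

Lemma opFLRE : opFLR M = (opE M `|` opGLR M)%O.
Proof.
apply/le_anti/andP; split.
  rewrite leSubE; apply: gen_min; rewrite !subUset -!leSubE leUl.
  by split; first split=> //; apply: le_trans (leUr _ _);
    [exact: opGL_le|exact: opGR_le].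
rewrite leUx; apply/andP; split; rewrite leSubE.
  by move=> x Ex; apply: gen_sub; left; left.
by apply: gen_min => x [Lx|Rx]; apply: gen_sub; [left; right|right].
Qed.

Definition idempotent_part : seq (submonoid M) := [:: opO M; opQ M; opE M].

Definition unit_part : seq (submonoid M) :=
  [:: opO M; opG M; opGL M; opGR M; opGLR M].

Lemma joinO S : (S `|` opO M)%O = S. Proof. exact/join_l/opO_le. Qed.
Lemma Ojoin S : (opO M `|` S)%O = S. Proof. exact/join_r/opO_le. Qed.

Lemma idempotent_part_join a b :
  a \in idempotent_part -> b \in idempotent_part ->
  (a `|` b)%O \in idempotent_part.
Proof.
have QE := opQ_le_opE.
rewrite !inE => /or3P[] /eqP-> /or3P[] /eqP->;
  by rewrite ?joinO ?Ojoin ?joinxx ?(join_l QE) ?(join_r QE) eqxx ?orbT.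
Qed.

(** The only incomparable members are [opGL] and [opGR], whose join is [opGLR]
    by definition. *)
Lemma unit_part_join a b :
  a \in unit_part -> b \in unit_part -> (a `|` b)%O \in unit_part.
Proof.
have LH := opGL_le M; have RH := opGR_le M.
have GL : (opG M <= opGL M)%O by exact: leIl.
have GR : (opG M <= opGR M)%O by exact: leIr.
have GH := le_trans GL LH.
have LR : (opGL M `|` opGR M)%O = opGLR M by [].
have RL : (opGR M `|` opGL M)%O = opGLR M by rewrite joinC.
rewrite !inE => /or4P[| | |/orP[]] /eqP-> /or4P[| | |/orP[]] /eqP->;
  by rewrite ?joinO ?Ojoin ?joinxx ?LR ?RL ?(join_l GL) ?(join_r GL)
    ?(join_l GR) ?(join_r GR) ?(join_l GH) ?(join_r GH) ?(join_l LH)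
    ?(join_r LH) ?(join_l RH) ?(join_r RH) eqxx ?orbT.
Qed.

Definition grid : seq (submonoid M) :=
  [seq (a `|` b)%O | a <- idempotent_part, b <- unit_part].

Lemma grid_join S T : S \in grid -> T \in grid -> (S `|` T)%O \in grid.
Proof.
case/allpairsP=> -[a b] /= [aE bG ->]; case/allpairsP=> -[a' b'] /= [a'E b'G ->].
rewrite joinACA; apply: allpairs_f; first exact: idempotent_part_join.
exact: unit_part_join.
Qed.

(** Writing out the sixteen terms and renaming each join turns the right-hand
    side into the fifteen operators, with [opGLR] occurring twice: as
    [opO `|` opGLR] and as [opQ `|` opGLR]. *)
Lemma LplusP S : Lplus M S <-> S \in opI M :: grid.
Proof.
(* [opF], [opFL] and [opFR] are generated by a union of two submonoids, which is
   how the join is defined. *)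
have FE : (opE M `|` opG M)%O = opF M by [].
have FLE : (opE M `|` opGL M)%O = opFL M by [].
have FRE : (opE M `|` opGR M)%O = opFR M by [].
rewrite /grid /= joinxx !Ojoin !joinO -opPE -opPLE -opPRE FE FLE FRE -opFLRE.
rewrite (join_r opQ_le_opGLR); split.
  by case=> X FX ->; move: FX; rewrite /Fplus /=;
    do 15?[case=> [<-|]]; rewrite // !inE eqxx ?orbT.
do 16?[case/predU1P => [->|]] => //;
  by eexists; last reflexivity; repeat (by left) || right.
Qed.

Lemma Lplus_join S T : Lplus M S -> Lplus M T -> Lplus M (S `|` T)%O.
Proof.
rewrite !LplusP; case/predU1P=> [->|Sgrid].
  by rewrite (join_l (le_opI _)) mem_head.
case/predU1P=> [->|Tgrid]; first by rewrite (join_r (le_opI _)) mem_head.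
by apply/predU1P; right; exact: grid_join.
Qed.

End Grid.

Theorem proposition6p1 (M : monoidType) :
  [/\ finite_set (Lplus M),
      (forall S T, Lplus M S -> Lplus M T -> Lplus M (S `|` T)%O),
      [/\ Lplus M (opI M), ubound (Lplus M) (opI M) & opI M = [set: M] :> set M],
      [/\ Lplus M (opO M), lbound (Lplus M) (opO M) & opO M = [set 1] :> set M]
    & is_lattice (set_type (Lplus M))].
Proof.
have finL : finite_set (Lplus M).
  apply/finite_seqP; exists (opI M :: grid M).
  by apply/seteqP; split=> S /LplusP.
have LO : Lplus M (opO M) by exists opO => //; left.
have lbO : lbound (Lplus M) (opO M) by move=> S _; exact: opO_le.
split=> //; first exact: Lplus_join.
  split=> //; first by apply/LplusP; exact: mem_head.
  by move=> S _; exact: le_opI.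
exact: finite_join_closed_is_lattice finL (@Lplus_join M) LO lbO.
Qed.
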